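(* Let $d \in \{1, 2, \ldots, n-1\}$. If $K$ is a compact convex subset of $\mathbb{R}^n$ having at least $d+2$ exposed points, then there exists a compact convex set $L \subseteq \mathbb{R}^n$ such that the projection $L_\xi$ contains a translate of the projection $K_\xi$ for each $d$-dimensional linear subspace $\xi$, while $L$ does not contain a translate of $K$.
   Context: For a set $S\subseteq\mathbb{R}^n$ and a linear subspace $\xi$, $S_\xi$ denotes the orthogonal projection of $S$ onto $\xi$. A point $x\in K$ is an exposed point of $K$ if there is a unit vector $u$ such that $x$ is the unique point of $K$ maximizing $y\mapsto y\cdot u$ over $K$. *)

(* Defs.v *)
From HB Require Import structures.
From mathcomp Require Import all_boot all_order all_algebra.
From mathcomp Require Import all_classical all_reals all_analysis.
Set Implicit Arguments. Unset Strict Implicit. Unset Printing Implicit Defensive.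
Import Order.TTheory GRing.Theory Num.Theory.
Import numFieldNormedType.Exports.
Local Open Scope classical_set_scope.
Local Open Scope ring_scope.

Definition dotv (R : realType) (n : nat) (x y : 'rV[R]_n) : R :=
  \sum_(i < n) x 0 i * y 0 i.

Definition convex (R : realType) (n : nat) (K : set 'rV[R]_n) : Prop :=
  forall x y (t : R), K x -> K y -> 0 <= t -> t <= 1 ->
    K (t *: x + (1 - t) *: y).

(* a linear subspace xi of R^n is represented as the row space of a square
   matrix U; its dimension is \rank U *)
Definition in_subspace (R : realType) (n : nat) (U : 'M[R]_n) (v : 'rV[R]_n) : bool :=
  (v <= U)%MS.

Definition proj_set (R : realType) (n : nat) (U : 'M[R]_n) (S : set 'rV[R]_n)
  : set 'rV[R]_n :=
  [set y | in_subspace U y /\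
     exists2 x, S x & forall w, in_subspace U w -> dotv (x - y) w = 0].

Definition contains_translate (R : realType) (n : nat) (B A : set 'rV[R]_n) : Prop :=
  exists t : 'rV[R]_n, forall a, A a -> B (a + t).

Definition exposed_point (R : realType) (n : nat) (K : set 'rV[R]_n) (x : 'rV[R]_n) : Prop :=
  K x /\ exists u : 'rV[R]_n, dotv u u = 1 /\
    forall y, K y -> y <> x -> dotv y u < dotv x u.

(* Main.v *)
(* Let f_0, .., f_n be normals of an n-simplex such that f_j exposes a point q_j
   of K and at least d+2 of the q_j are distinct.  Let L be the simplex
   {x | x.f_j <= h_K(f_j) - s for all j}, cut down to a large box.  If K + v were
   contained in L, then v.f_j <= -s for all j, contradicting a positive linear
   dependency of the f_j.  On the other hand, small caps of K at distinct q_j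
   are disjoint, so d+1 points of K miss the cap at some q_i; translating them
   in a direction t with t.f_j < 0 for all j <> i moves them into L when s is
   small.  By Helly's theorem in the d-dimensional subspace, the projection of L
   then contains a translate of the projection of K.

   Exposing simplex normals exist because exposing directions are dense.  To
   increase the number of distinct q_j: if q_i = q_j with i <> j and u exposes a
   new point, write -u = sum b_k f_k with all b_k > 0 and replace f_i, f_j by
   b_i f_i + b_j f_j (which still exposes q_i) and u; this is again a family of
   simplex normals for u in general position. *)

Require Import Defs.
From HB Require Import structures.
From mathcomp Require Import all_boot all_order all_algebra.
From mathcomp Require Import all_classical all_reals all_analysis.
From mathcomp Require Import ring lra.
Set Implicit Arguments. Unset Strict Implicit. Unset Printing Implicit Defensive.
Import Order.TTheory GRing.Theory Num.Theory.
Import numFieldNormedType.Exports.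
Local Open Scope classical_set_scope.
Local Open Scope ring_scope.

(** * Dot product and compactness preliminaries *)

Lemma dotv_mxE (R : realType) (n : nat) (x y : 'rV[R]_n) :
  dotv x y = (x *m y^T) 0 0.
Proof. by rewrite /dotv mxE; apply: eq_bigr => i _; rewrite mxE. Qed.

Lemma dotvC (R : realType) (n : nat) (x y : 'rV[R]_n) : dotv x y = dotv y x.
Proof. by apply: eq_bigr => i _; rewrite mulrC. Qed.

Lemma dotvDl (R : realType) (n : nat) (x y z : 'rV[R]_n) :
  dotv (x + y) z = dotv x z + dotv y z.
Proof. by rewrite !dotv_mxE mulmxDl mxE. Qed.

Lemma dotvBl (R : realType) (n : nat) (x y z : 'rV[R]_n) :
  dotv (x - y) z = dotv x z - dotv y z.
Proof. by rewrite !dotv_mxE mulmxBl !mxE. Qed.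

Lemma dotvZl (R : realType) (n : nat) (a : R) (x z : 'rV[R]_n) :
  dotv (a *: x) z = a * dotv x z.
Proof. by rewrite !dotv_mxE -scalemxAl mxE. Qed.

Lemma dotvDr (R : realType) (n : nat) (x y z : 'rV[R]_n) :
  dotv z (x + y) = dotv z x + dotv z y.
Proof. by rewrite dotvC dotvDl !(dotvC _ z). Qed.

Lemma dotvZr (R : realType) (n : nat) (a : R) (x z : 'rV[R]_n) :
  dotv z (a *: x) = a * dotv z x.
Proof. by rewrite dotvC dotvZl dotvC. Qed.

Lemma dotv_gt0 (R : realType) (n : nat) (x : 'rV[R]_n) :
  x != 0 -> 0 < dotv x x.
Proof.
move=> /rV0Pn[i xi0]; rewrite /dotv (bigD1 i) //= ltr_pwDl //.
  by rewrite -expr2 exprn_even_gt0.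
by apply: sumr_ge0 => j _; rewrite -expr2 sqr_ge0.
Qed.

Lemma dotv_row (R : realType) (m n : nat) (x : 'rV[R]_n) (F : 'M[R]_(m, n)) j :
  dotv x (row j F) = (F *m x^T) j 0.
Proof. by rewrite dotvC /dotv [RHS]mxE; apply: eq_bigr => i _; rewrite !mxE. Qed.


Lemma dotv_continuous (R : realType) (n : nat) (f g : 'rV[R]_n -> 'rV[R]_n) :
  continuous f -> continuous g -> continuous (fun x => dotv (f x) (g x)).
Proof.
move=> cf cg; rewrite /dotv; elim: (index_enum _) => [|i s IH] x.
  rewrite (_ : (fun _ => _) = cst 0); last by apply/funext => y; rewrite big_nil.
  exact: cst_continuous.
rewrite (_ : (fun _ => _) = (fun y => f y 0 i * g y 0 i) \+
    (fun y => \sum_(j <- s) f y 0 j * g y 0 j)); last first.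
  by apply/funext => y; rewrite big_cons.
apply: continuousD (IH x).
apply: continuousM.
  apply: (@continuous_comp _ _ _ f (fun y : 'rV[R]_n => y 0 i) x (cf x)).
  exact: coord_continuous.
apply: (@continuous_comp _ _ _ g (fun y : 'rV[R]_n => y 0 i) x (cg x)).
exact: coord_continuous.
Qed.

Lemma compact_coord_bounded (R : realType) (n : nat) (K : set 'rV[R]_n) :
  compact K -> exists2 C : R, 0 < C & forall x, K x -> forall l, `|x 0 l| <= C.
Proof.
move=> /compact_bounded [M [_ HM]].
exists (`|M| + 1) => [|x Kx l]; first by rewrite ltr_wpDl.
have MM : M < `|M| + 1 by rewrite (le_lt_trans (ler_norm M))// ltrDl.
apply: le_trans (_ : `|x| <= _); last exact: HM Kx.
rewrite [leRHS]mx_normrE; exact: (le_bigmax _ (fun ij => `|x ij.1 ij.2|) (ord0, l)).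
Qed.

(** The minimum of finitely many admissible bounds stays positive and, by monotonicity, admissible.
    This supplies the uniform gap, cap depth and shift size below. *)
Lemma finite_pos_min (R : realType) (I : finType) (P : I -> R -> Prop) :
  (forall i e e', 0 < e' -> e' <= e -> P i e -> P i e') ->
  (forall i, exists2 e : R, 0 < e & P i e) ->
  exists2 e : R, 0 < e & forall i, P i e.
Proof.
move=> mono ex.
suff [e e0 He] : exists2 e : R, 0 < e & forall i, i \in enum I -> P i e.
  by exists e => // i; apply: He; rewrite mem_enum.
elim: (enum I) => [|i s [e e0 He]]; first by exists 1.
have [e1 e10 Pe1] := ex i.
have m0 : 0 < Num.min e e1 by rewrite lt_min e0.
exists (Num.min e e1) => // j; rewrite inE => /orP[/eqP->|js].
  by apply: mono Pe1 => //; rewrite ge_min lexx orbT.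
by apply: mono (He _ js) => //; rewrite ge_min lexx.
Qed.

(** * Exposing directions and families of simplex normals *)

(** The direction is not normalised, so that exposing directions of the same point can be rescaled
    and added. *)
Definition exposes (R : realType) (n : nat) (K : set 'rV[R]_n) (f q : 'rV[R]_n) :=
  K q /\ forall y, K y -> y <> q -> dotv y f < dotv q f.

Lemma exposesD (R : realType) (n : nat) (K : set 'rV[R]_n) (f g q : 'rV[R]_n) a b :
  0 < a -> 0 < b -> exposes K f q -> exposes K g q ->
  exposes K (a *: f + b *: g) q.
Proof.
move=> a0 b0 [Kq fq] [_ gq]; split => // y Ky yq.
by rewrite !dotvDr !dotvZr ltrD// ltr_pM2l//; [exact: fq|exact: gq].
Qed.

Lemma exposes_le (R : realType) (n : nat) (K : set 'rV[R]_n) (f q y : 'rV[R]_n) :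
  exposes K f q -> K y -> dotv y f <= dotv q f.
Proof.
move=> [_ fq] Ky; have [->//|/eqP yq] := eqVneq y q.
exact/ltW/fq.
Qed.

(* At a maximizer [q] of the strictly convex function
   [x |-> x.z + (e/2) |x|^2] the gradient [z + e q] exposes [q]. *)
Lemma exposes_near (R : realType) (n : nat) (K : set 'rV[R]_n) (z : 'rV[R]_n) (e : R) :
  compact K -> K !=set0 -> 0 < e ->
  exists2 q, exposes K (z + e *: q) q &
    forall x, K x -> dotv x z + e / 2 * dotv x x <= dotv q z + e / 2 * dotv q q.
Proof.
move=> cK K0 e0.
have cid : continuous (@idfun 'rV[R]_n) by move=> x; exact: cvg_id.
have cphi : continuous (fun x => dotv x z + e / 2 * dotv x x).
  move=> x; apply: (@continuousD _ _ _ (fun y => dotv y z) (fun y => _ * dotv y y)).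
    exact: (dotv_continuous cid (@cst_continuous _ _ z)).
  apply: (@continuousM _ _ (fun=> e / 2)); first exact: cst_continuous.
  exact: (dotv_continuous cid cid).
have [q /set_mem Kq qmax] := compact_EVT_max K0 cK (continuous_subspaceT cphi).
exists q => [|x Kx]; last by apply: qmax; rewrite inE.
split => // y Ky yq.
have := qmax y; rewrite inE => /(_ Ky).
have := @dotv_gt0 _ _ (y - q); rewrite subr_eq0 => /(_ (introN eqP yq)).
(* Adding e/2 times this positive quantity to the maximality inequality at y makes it strict and
   linear in y. *)
have -> : dotv (y - q) (y - q) = dotv y y - 2 * dotv y q + dotv q q.
  by rewrite dotvBl !(dotvC _ (y - q)) !dotvBl (dotvC q y); ring.
rewrite !dotvDr !dotvZr; nra.
Qed.

(* The rows of [F] are, up to positive scaling, the outward normals of an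
   n-simplex. *)
Definition simplicial (R : realType) (n : nat) (F : 'M[R]_(n.+1, n)) :=
  forall c : 'rV[R]_n.+1, c != 0 -> c *m F = 0 ->
    (forall j, 0 < c 0 j) \/ (forall j, c 0 j < 0).

Lemma simplicial_pos (R : realType) (n : nat) (F : 'M[R]_(n.+1, n)) :
  simplicial F -> exists2 c : 'rV[R]_n.+1, (forall j, 0 < c 0 j) & c *m F = 0.
Proof.
move=> sF; pose v := nz_row (kermx F).
have v0 : v != 0.
  rewrite nz_row_eq0 -mxrank_eq0 mxrank_ker -lt0n subn_gt0.
  exact: leq_ltn_trans (rank_leq_col F) _.
have vF : v *m F = 0 by apply/sub_kermxP; exact: nz_row_sub.
have [vp|vn] := sF v v0 vF; first by exists v.
exists (- v) => [j|]; last by rewrite mulNmx vF oppr0.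
by rewrite mxE oppr_gt0.
Qed.

(** A nonzero kernel vector has no zero entry, so the multiple of [c] that cancels one entry of [y]
    cancels all of it. *)
Lemma simplicial_ker (R : realType) (n : nat) (F : 'M[R]_(n.+1, n))
    (c y : 'rV[R]_n.+1) :
  simplicial F -> (forall j, 0 < c 0 j) -> c *m F = 0 -> y *m F = 0 ->
  exists s, y = s *: c.
Proof.
move=> sF c0 cF yF; exists (y 0 0 / c 0 0); apply/eqP; rewrite -subr_eq0.
apply: contraT => /sF[]; first by rewrite mulmxBl -scalemxAl cF yF scaler0 subr0.
  by move=> /(_ 0); rewrite !mxE divfK ?subrr ?ltxx// gt_eqF.
by move=> /(_ 0); rewrite !mxE divfK ?subrr ?ltxx// gt_eqF.
Qed.

Lemma simplicial_rank (R : realType) (n : nat) (F : 'M[R]_(n.+1, n)) :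
  simplicial F -> \rank F = n.
Proof.
move=> sF; have [c c0 cF] := simplicial_pos sF.
have : (kermx F <= c)%MS.
  apply/row_subP => i; have : row i (kermx F) *m F = 0.
    by apply/sub_kermxP; exact: row_sub.
  by move=> /(simplicial_ker sF c0 cF)[s ->]; exact: scalemx_sub.
move=> /mxrankS; rewrite mxrank_ker => /leq_trans/(_ (rank_leq_row _)).
by rewrite leq_subLR addn1 ltnS => rF; apply/eqP; rewrite eqn_leq rank_leq_col.
Qed.

Lemma simplicial_span (R : realType) (n : nat) (F : 'M[R]_(n.+1, n)) (u : 'rV[R]_n) :
  simplicial F -> exists y, u = y *m F.
Proof.
move=> /simplicial_rank rF; apply/submxP; apply: submx_full.
by rewrite /row_full rF.
Qed.

(** The column space of [F] has dimension n and lies in the hyperplane orthogonal to [c], hence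
    equals it. This makes it possible to prescribe the products of [w] with all the normals. *)
Lemma simplicial_solve (R : realType) (n : nat) (F : 'M[R]_(n.+1, n))
    (c : 'rV[R]_n.+1) (b : 'cV[R]_n.+1) :
  simplicial F -> (forall j, 0 < c 0 j) -> c *m F = 0 -> c *m b = 0 ->
  exists w : 'rV[R]_n, F *m w^T = b.
Proof.
move=> sF c0 cF cb.
have FTker : (F^T <= kermx c^T)%MS by apply/sub_kermxP; rewrite -trmx_mul cF trmx0.
have c_neq0 : c != 0.
  by apply/eqP => /rowP/(_ 0); rewrite mxE => c00; have := c0 0; rewrite c00 ltxx.
have : (kermx c^T <= F^T)%MS.
  have := mxrank_leqif_eq FTker; rewrite mxrank_ker !mxrank_tr (simplicial_rank sF).
  by rewrite rank_rV c_neq0 subn1 /= => -[_]; rewrite eqxx => /esym/andP[].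
have : (b^T <= kermx c^T)%MS by apply/sub_kermxP; rewrite -trmx_mul cb trmx0.
move=> /submx_trans /[apply] /submxP[w bw]; exists w.
by apply: trmx_inj; rewrite trmx_mul trmxK.
Qed.

(* Some perturbation of [(-sum e_l, e_1, .., e_n)] is exposing. *)
Lemma exists_simplicial_exposing (R : realType) (n : nat) (K : set 'rV[R]_n) :
  compact K -> K !=set0 ->
  exists F : 'M[R]_(n.+1, n), simplicial F /\
    exists q, forall j, exposes K (row j F) (q j).
Proof.
move=> cK K0; have [C C0 KC] := compact_coord_bounded cK.
(* With this [e], the n+1 perturbations [e *: q j] together contribute less than 1/2 to any
   coordinate. *)
pose e := (n.+2%:R * 2 * C)^-1.
have D0 : 0 < n.+2%:R * 2 * C by rewrite !mulr_gt0.
have e0 : 0 < e by rewrite invr_gt0.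
pose z (j : 'I_n.+1) : 'rV[R]_n :=
  if unlift ord0 j is Some l then delta_mx 0 l else const_mx (-1).
have eC : n.+1%:R * (e * C) < 2^-1.
  have -> : e * C = n.+2%:R^-1 / 2.
    by rewrite /e invfM -mulrA mulVf ?mulr1 ?gt_eqF// invfM.
  by rewrite mulrA gtr_pMl// ltr_pdivrMr// mul1r ltr_nat.
have ex j : exists q, exposes K (z j + e *: q) q.
  by have [q Hq _] := exposes_near (z j) cK K0 e0; exists q.
have [q Hq] := choice ex.
exists (\matrix_j (z j + e *: q j)); split; last by exists q => j; rewrite rowK.
move=> c c0 cF.
have [m mmax] : exists m, forall j, `|c 0 j| <= `|c 0 m|.
  by exists [arg max_(i > ord0) `|c 0 i|]%O; case: arg_maxP => // i _ H j; exact: H.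
have cm0 : 0 < `|c 0 m|.
  have /rV0Pn[i ci] := c0; apply: lt_le_trans (mmax i); by rewrite normr_gt0.
(* Coordinate l of [c *m F = 0] expresses this difference through the perturbations alone. *)
have half l : `|c 0 (lift ord0 l) - c 0 ord0| < `|c 0 m| / 2.
  have /rowP/(_ l) := cF; rewrite !mxE big_ord_recl !mxE /z unlift_none mxE.
  under eq_bigr => j _ do rewrite !mxE liftK mxE eqxx /= mulrDr.
  rewrite big_split /= (bigD1 l)//= eqxx mulr1 big1 ?addr0; last first.
    by move=> j jl; rewrite eq_sym (negbTE jl) mulr0.
  move=> E.
  have -> : c 0 (lift ord0 l) - c 0 ord0 = - \sum_j c 0 j * (e * q j 0 l).
    by rewrite big_ord_recl; move: E; lra.
  rewrite normrN; apply: le_lt_trans (ler_norm_sum _ _ _) _.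
  apply: (@le_lt_trans _ _ (\sum_(j < n.+1) `|c 0 m| * (e * C))).
    apply: ler_sum => j _; rewrite !normrM (gtr0_norm e0).
    apply: ler_pM => //; first by apply: mulr_ge0 => //; exact: ltW.
    by rewrite ler_pM2l//; apply: KC; case: (Hq j).
  by rewrite sumr_const card_ord -[ltLHS]mulr_natl [ltLHS]mulrCA ltr_pM2l.
(* Every entry is closer to [c 0 m] than [c 0 m] is to 0, so all entries share its sign. *)
have near j : `|c 0 j - c 0 m| < `|c 0 m|.
  have H k : `|c 0 k - c 0 ord0| < `|c 0 m| / 2.
    case: (unliftP ord0 k) => [l ->|->]; first exact: half.
    by rewrite subrr normr0 divr_gt0.
  have -> : c 0 j - c 0 m = (c 0 j - c 0 ord0) - (c 0 m - c 0 ord0) by ring.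
  by rewrite (le_lt_trans (ler_normB _ _))// (splitr `|c 0 m|) ltrD.
have [cmp|cmn|cm] := ltrgtP (c 0 m) 0.
- right=> j; have := near j; rewrite (ltr0_norm cmp) ltr_norml; lra.
- left=> j; have := near j; rewrite (gtr0_norm cmn) ltr_norml; lra.
- by move: cm0; rewrite cm normr0 ltxx.
Qed.

(** * Exchanging normals to expose more points *)

Lemma compact_bounded_fun (R : realType) (T : topologicalType) (K : set T) (f : T -> R) :
  compact K -> continuous f -> exists2 C : R, 0 < C & forall x, K x -> `|f x| <= C.
Proof.
move=> cK cf; have := continuous_compact (continuous_subspaceT cf) cK.
move=> /(@compact_bounded _ R^o) [M [_ HM]].
exists (`|M| + 1) => [|x Kx]; first by rewrite ltr_wpDl.
have MM : M < `|M| + 1 by rewrite (le_lt_trans (ler_norm M))// ltrDl.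
by apply: (HM _ MM); exists x.
Qed.

(** A slight tilt of [u] towards [w] leaves the hyperplane orthogonal to [w]; if small against the
    gap between [p] and the [q j], it cannot make any [q j] the exposed point. *)
Lemma exposes_perturb (R : realType) (n m : nat) (K : set 'rV[R]_n)
    (u p w : 'rV[R]_n) (q : 'I_m -> 'rV[R]_n) :
  compact K -> exposes K u p -> (forall j, K (q j)) -> (forall j, q j <> p) -> w != 0 ->
  exists u' p', [/\ exposes K u' p', forall j, q j <> p' & dotv u' w != 0].
Proof.
move=> cK [Kp up] Kq qp w0.
have [uw0|uw0] := eqVneq (dotv u w) 0; last by exists u, p.
have cid : continuous (@idfun 'rV[R]_n) by move=> x; exact: cvg_id.
have [C1 C10 KC1] := compact_bounded_fun cK (dotv_continuous cid (@cst_continuous _ _ w)).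
have [C2 C20 KC2] := compact_bounded_fun cK (dotv_continuous cid cid).
have [g g0 gP] : exists2 g : R, 0 < g & forall j, g <= dotv p u - dotv (q j) u.
  apply: finite_pos_min => [i e e' _ /le_trans|i]; first by move=> /[apply].
  by exists (dotv p u - dotv (q i) u) => //; rewrite subr_gt0; exact: up.
have ww0 := dotv_gt0 w0.
(* The tilt changes values on K by at most g/4, and the quadratic term is also at most g/4, so no
   [q j] can beat [p]. The second bound in [e] keeps [e *: p'] from cancelling [eta *: w] against
   [w]. *)
pose eta := g / (4 * C1).
have eta0 : 0 < eta by rewrite divr_gt0// mulr_gt0.
have etaC : eta * C1 = g / 4 by rewrite /eta; field; rewrite gt_eqF.
pose e := Num.min (g / (2 * C2)) (eta * dotv w w / (2 * C1)).
have e0 : 0 < e by rewrite lt_min; apply/andP; split; apply: divr_gt0 => //; apply: mulr_gt0.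
have eC2 : e * C2 <= g / 2.
  have : e <= g / (2 * C2) by rewrite ge_min lexx.
  by rewrite ler_pdivlMr ?mulr_gt0//; lra.
have eC1 : e * C1 <= eta * dotv w w / 2.
  have : e <= eta * dotv w w / (2 * C1) by rewrite ge_min lexx orbT.
  by rewrite ler_pdivlMr ?mulr_gt0//; lra.
have [p' Hp' max] := exposes_near (u + eta *: w) cK (ex_intro K p Kp) e0.
exists (u + eta *: w + e *: p'), p'; split => //.
- move=> j jp'; have := max _ Kp; rewrite -jp' !dotvDr !dotvZr.
  have /ler_normlP[A1 A2] := KC1 _ Kp; have /ler_normlP[B1 B2] := KC1 _ (Kq j).
  have /ler_normlP[D1 D2] := KC2 _ Kp; have /ler_normlP[E1 E2] := KC2 _ (Kq j).
  have := gP j.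
  have : eta * dotv (q j) w <= eta * C1 by rewrite ler_pM2l.
  have : eta * - dotv p w <= eta * C1 by rewrite ler_pM2l.
  have : e * dotv (q j) (q j) <= e * C2 by rewrite ler_pM2l.
  have : 0 <= e * dotv p p.
    apply: mulr_ge0; first exact: ltW.
    by have [->|/dotv_gt0/ltW//] := eqVneq p 0; rewrite dotv_mxE mul0mx mxE.
  lra.
- have [Kp' _] := Hp'.
  have /ler_normlP[A1 A2] := KC1 _ Kp'.
  rewrite !dotvDl !dotvZl uw0 gt_eqF//.
  have : e * - dotv p' w <= e * C1 by rewrite ler_pM2l.
  have : 0 < eta * dotv w w by rewrite mulr_gt0.
  lra.
Qed.

(** A dependency x of the new rows pulls back to a multiple of [c]. Its entries i and j are both
    [x 0 i - x 0 j] times those of [b]; as these are not proportional to those of [c], the multiple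
    is 0. Then every entry of x is [x 0 j] up to a positive factor. *)
Lemma simplicial_exchange (R : realType) (n : nat) (F : 'M[R]_(n.+1, n))
    (c b : 'rV[R]_n.+1) (i j : 'I_n.+1) :
  simplicial F -> (forall k, 0 < c 0 k) -> c *m F = 0 -> (forall k, 0 < b 0 k) ->
  i != j -> b 0 i * c 0 j != b 0 j * c 0 i ->
  simplicial (\matrix_k if k == j then - (b *m F)
                        else if k == i then b 0 i *: row i F + b 0 j *: row j F
                        else row k F).
Proof.
move=> sF c0 cF b0 ij bc x x0.
pose T : 'M[R]_n.+1 := \matrix_k if k == j then - b
  else if k == i then b 0 i *: delta_mx 0 i + b 0 j *: delta_mx 0 j else delta_mx 0 k.
have -> : (\matrix_k if k == j then - (b *m F)
    else if k == i then b 0 i *: row i F + b 0 j *: row j F else row k F) = T *m F.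
  apply/row_matrixP => k; rewrite row_mul !rowK; case: ifP => _; first by rewrite mulNmx.
  by case: ifP => _; rewrite ?mulmxDl -?scalemxAl -!rowE.
rewrite mulmxA => /(simplicial_ker sF c0 cF)[s xT].
have entry k : s * c 0 k = - (x 0 j * b 0 k) +
    (if k == i then x 0 i * b 0 i else if k == j then x 0 i * b 0 j else x 0 k).
  have /rowP/(_ k) := xT; rewrite !mxE => <-.
  rewrite (bigD1 j)//= (bigD1 i)//= !mxE eqxx (negbTE ij) eqxx !mxE mulrN eqxx /=.
  congr (_ + _); have [->|ki] := eqVneq k i.
    rewrite (negbTE ij) !mulr0 addr0 mulr1 big1 ?addr0// => l /andP[lj li].
    by rewrite !mxE (negbTE lj) (negbTE li) mxE eqxx eq_sym (negbTE li) mulr0.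
  have [->|kj] := eqVneq k j.
    rewrite !mulr0 add0r mulr1 big1 ?addr0// => l /andP[lj li].
    by rewrite !mxE (negbTE lj) (negbTE li) mxE eqxx eq_sym (negbTE lj) mulr0.
  rewrite !mulr0 addr0 mulr0 add0r (bigD1 k) ?kj//= !mxE (negbTE kj) (negbTE ki).
  rewrite !mxE !eqxx mulr1 big1 ?addr0// => l /andP[/andP[lj li] lk].
  by rewrite !mxE (negbTE lj) (negbTE li) mxE eqxx eq_sym (negbTE lk) mulr0.
have Ei := entry i; have Ej := entry j.
rewrite eqxx in Ei; rewrite eq_sym (negbTE ij) eqxx in Ej.
have xij : x 0 i = x 0 j.
  apply/eqP; rewrite -subr_eq0; have : (x 0 i - x 0 j) * (b 0 i * c 0 j - b 0 j * c 0 i) = 0.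
    transitivity ((s * c 0 i) * c 0 j - (s * c 0 j) * c 0 i); last by ring.
    by rewrite Ei Ej; ring.
  by move=> /eqP; rewrite mulf_eq0 => /orP[//|]; rewrite (subr_eq0 (b 0 i * c 0 j)) (negbTE bc).
have s0 : s = 0.
  apply/eqP; have : s * c 0 i == 0 by rewrite Ei xij addNr.
  by rewrite mulf_eq0 (gt_eqF (c0 i)) orbF.
have xk k : k != i -> x 0 k = x 0 j * b 0 k \/ k = j.
  move=> ki; have [->|kj] := eqVneq k j; [by right|left].
  by have := entry k; rewrite s0 (negbTE ki) (negbTE kj); lra.
have sgn k : x 0 k = x 0 j \/ x 0 k = x 0 j * b 0 k.
  have [->|/xk[->|->]] := eqVneq k i; [by left|by right|by left].
have [xj|xj|xj] := ltrgtP (x 0 j) 0.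
- by right=> k; case: (sgn k) => -> //; rewrite nmulr_rlt0.
- by left=> k; case: (sgn k) => -> //; rewrite mulr_gt0.
- move: x0; rewrite (_ : x = 0) ?eqxx//; apply/rowP => k; rewrite mxE.
  by case: (sgn k) => ->; rewrite xj ?mul0r.
Qed.

Lemma injective_oapp (T : eqType) (m : nat) (f : 'I_m -> T) (x : T) :
  injective f -> x \notin codom f ->
  injective (fun i : 'I_m.+1 => oapp f x (unlift ord0 i)).
Proof.
move=> fI xf i j; case: (unliftP ord0 i) => [k ->|->];
  case: (unliftP ord0 j) => [l ->|->] //=.
- by move=> /fI ->.
- by move=> fx; rewrite -fx codom_f in xf.
- by move=> fx; rewrite fx codom_f in xf.
Qed.

(** Both normals i and j expose the same point, so their positive combination at index i still does,
    which frees index j for a new point. *)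
Lemma simplicial_merge (R : realType) (n : nat) (K : set 'rV[R]_n)
    (F : 'M[R]_(n.+1, n)) (q : 'I_n.+1 -> 'rV[R]_n) (i j : 'I_n.+1)
    (u p : 'rV[R]_n) :
  compact K -> simplicial F -> (forall k, exposes K (row k F) (q k)) ->
  i != j -> q i = q j -> exposes K u p -> (forall k, q k <> p) ->
  exists (F' : 'M[R]_(n.+1, n)) p', [/\ simplicial F', forall k, q k <> p' &
    forall k, exposes K (row k F') (if k == j then p' else q k)].
Proof.
move=> cK sF Fq ij qij up qp.
have [c c0 cF] := simplicial_pos sF.
(* This [w] encodes general position: pairing it with [b *m F] gives
   [b 0 i * c 0 j - b 0 j * c 0 i]. *)
have [w Fw] : exists w : 'rV_n, F *m w^T = c 0 j *: delta_mx i 0 - c 0 i *: delta_mx j 0.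
  apply: (simplicial_solve sF c0 cF).
  rewrite mulmxBr -!scalemxAr -!colE; apply/rowP => k; rewrite !mxE; ring.
have w0 : w != 0.
  apply/eqP => w0; move: Fw => /colP/(_ i).
  rewrite w0 trmx0 mulmx0 !mxE eqxx (negbTE ij) mulr1 mulr0 subr0 => /esym/eqP.
  by rewrite gt_eqF.
have Kq k : K (q k) by case: (Fq k).
have [v [p' [vp' qp' vw]]] := exposes_perturb cK up Kq qp w0.
have [y vy] := simplicial_span (- v) sF.
have [b b0 bF] : exists2 b : 'rV_n.+1, forall k, 0 < b 0 k & b *m F = - v.
  (* Adding a large multiple of the dependency [c] makes all coefficients positive without changing
     the combination. *)
  pose s := \sum_k (`|y 0 k| / c 0 k) + 1.
  exists (y + s *: c); last by rewrite mulmxDl -vy -scalemxAl cF scaler0 addr0.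
  move=> k; have : (`|y 0 k| / c 0 k + 1) * c 0 k <= s * c 0 k.
    rewrite ler_pM2r// lerD2r (bigD1 k)//= lerDl sumr_ge0// => l _.
    by rewrite divr_ge0// ltW.
  rewrite mulrDl divfK ?gt_eqF// mul1r !mxE.
  by have := ler_norm (- y 0 k); rewrite normrN; have := c0 k; lra.
have bc : b 0 i * c 0 j != b 0 j * c 0 i.
  apply: contra vw => /eqP bc; rewrite dotv_mxE -[v]opprK -bF mulNmx -mulmxA Fw.
  by rewrite mulmxBr -!scalemxAr -!colE !mxE; apply/eqP; lra.
have := simplicial_exchange sF c0 cF b0 ij bc; set F' := \matrix_k _ => sF'.
exists F', p'; split => //.
move=> k; rewrite rowK; case: ifP => kj; first by rewrite bF opprK.
case: ifP => [/eqP->|_]; last exact: Fq.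
by apply: exposesD => //; rewrite qij.
Qed.

(** Induction on the number m of distinct points, with [g] selecting indices at which they occur. *)
Lemma simplicial_exposing_injective (R : realType) (n m0 m : nat) (K : set 'rV[R]_n)
    (u p : 'I_m0 -> 'rV[R]_n) :
  compact K -> K !=set0 -> injective p -> (forall i, exposes K (u i) (p i)) ->
  (m <= m0)%N -> (m <= n.+1)%N ->
  exists (F : 'M[R]_(n.+1, n)) (q : 'I_n.+1 -> 'rV[R]_n) (g : 'I_m -> 'I_n.+1),
    [/\ simplicial F, forall j, exposes K (row j F) (q j) & injective (q \o g)].
Proof.
move=> cK K0 pI up; elim: m => [_ _|m IH mm0 mn].
  have [F [sF [q Fq]]] := exists_simplicial_exposing cK K0.
  by exists F, q, (fun=> ord0); split => // -[].
have [F [q [g [sF Fq qgI]]]] := IH (ltnW mm0) (ltnW mn).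
have extend (q' : 'I_n.+1 -> 'rV[R]_n) (j : 'I_n.+1) :
    (q' \o g) =1 (q \o g) -> q' j \notin codom (q \o g) ->
    injective (q' \o (fun i => oapp g j (unlift ord0 i))).
  move=> q'g qj; apply: eq_inj (injective_oapp qgI qj) _ => i /=.
  by case: (unlift ord0 i) => //= l; rewrite -[LHS]q'g.
have [[j qj]|qall] := pselect (exists j, q j \notin codom (q \o g)).
  by exists F, q, (fun i => oapp g j (unlift ord0 i)); split => //; exact: extend.
have [i pi] : exists i, p i \notin codom (q \o g).
  apply: contrapT => /forallNP pc.
  suff: (m0 <= m)%N by rewrite leqNgt mm0.
  have := @uniq_leq_size _ (codom p) (codom (q \o g)).
  rewrite !size_codom !card_ord; apply; first exact/injectiveP.
  by move=> _ /codomP[k ->]; apply: contrapT => /negP; exact: pc.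
(* No [q j] is new, so the point at an unselected index [b] repeats a selected one, and [b] can be
   given to a new point. *)
have [b bg] : exists b, b \notin codom g.
  apply: contrapT => /forallNP bc.
  suff: (n.+1 <= m)%N by rewrite leqNgt mn.
  have := @uniq_leq_size _ (enum 'I_n.+1) (codom g).
  rewrite size_enum_ord size_codom card_ord; apply; first exact: enum_uniq.
  by move=> k _; apply: contrapT => /negP; exact: bc.
have qin j : q j \in codom (q \o g).
  by apply: contrapT => /negP qj; apply: qall; exists j.
have /codomP[k qbk] := qin b.
have kb : g k != b by apply: contra bg => /eqP <-; exact: codom_f.
have qp j : q j <> p i by move=> qj; move: pi; rewrite -qj qin.
have [F' [p' [sF' qp' Fq']]] := simplicial_merge cK sF Fq kb (esym qbk) (up i) qp.
exists F', (fun l => if l == b then p' else q l), (fun i => oapp g b (unlift ord0 i)).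
split => //; apply: extend => [l|] /=.
  by case: eqP => // glb; move: bg; rewrite -glb codom_f.
rewrite eqxx; apply/negP => /codomP[l p'l]; exact: (qp' (g l)).
Qed.

(** * The truncated simplex L *)

(** Since [p] and [q] differ, no point of K maximizes both f and g. Hence the maximum of f + g on K
    is less than the sum of the two maxima, and half the deficit serves as [e]. *)
Lemma exposes_caps_disjoint (R : realType) (n : nat) (K : set 'rV[R]_n)
    (f g p q : 'rV[R]_n) :
  compact K -> exposes K f p -> exposes K g q -> p <> q ->
  exists2 e : R, 0 < e & forall x, K x ->
    dotv x f <= dotv p f - e \/ dotv x g <= dotv q g - e.
Proof.
move=> cK fp gq pq.
have cid : continuous (@idfun 'rV[R]_n) by move=> x; exact: cvg_id.
have cfg := dotv_continuous cid (@cst_continuous _ _ (f + g)).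
have Kp : K p by case: fp.
have [x0 /set_mem Kx0 x0max] :=
  compact_EVT_max (ex_intro K p Kp) cK (continuous_subspaceT cfg).
have lt0 : dotv x0 (f + g) < dotv p f + dotv q g.
  rewrite dotvDr; have [x0p|/eqP x0p] := eqVneq x0 p.
    by rewrite x0p ltrD2l; case: gq => _; apply.
  by apply: ltr_leD; [case: fp => _; exact|exact: exposes_le gq Kx0].
exists ((dotv p f + dotv q g - dotv x0 (f + g)) / 2) => [|x Kx].
  by rewrite divr_gt0// subr_gt0.
have := x0max x; rewrite inE => /(_ Kx); rewrite /= (dotvDr f g x) => xx0.
have [|xf] := leP; [by left|right; lra].
Qed.

(** Common translates of d+1 points are exactly what Helly's theorem in dimension d consumes. *)
Lemma contains_translates_not_translate (R : realType) (n d : nat) (K : set 'rV[R]_n) :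
  (d < n)%N -> compact K ->
  (exists p : 'I_(d.+2) -> 'rV[R]_n,
      injective p /\ forall i, exposed_point K (p i)) ->
  exists L : set 'rV[R]_n, [/\ compact L, convex L,
    forall X : 'I_d.+1 -> 'rV[R]_n, (forall k, K (X k)) ->
      exists t, forall k, L (X k + t)
  & ~ contains_translate L K].
Proof.
move=> dn cK [p [pI pexp]].
have /choice[u up] i : exists u, exposes K u (p i).
  by have [Kp [u [_ up]]] := pexp i; exists u.
have K0 : K !=set0 by exists (p ord0); case: (up ord0).
have [F [q [g [sF Fq qgI]]]] := simplicial_exposing_injective cK K0 pI up (leqnn _) dn.
have [c c0 cF] := simplicial_pos sF.
pose h j := dotv (q j) (row j F).
have [e e0 eP] : exists2 e : R, 0 < e & forall ij : 'I_d.+2 * 'I_d.+2, ij.1 != ij.2 ->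
    forall x, K x -> dotv x (row (g ij.1) F) <= h (g ij.1) - e \/
                     dotv x (row (g ij.2) F) <= h (g ij.2) - e.
  apply: finite_pos_min => [[i j] e e' _ e'e H ij x /(H ij)[]|[i j]] /=.
  - by move=> ?; left; lra.
  - by move=> ?; right; lra.
  - have [->|ij] := eqVneq i j; first by exists 1.
    have qij : q (g i) <> q (g j) by move=> /qgI ij'; rewrite ij' eqxx in ij.
    have [e e0 eP] := exposes_caps_disjoint cK (Fq (g i)) (Fq (g j)) qij.
    by exists e.
(* The value at i is then forced by [c]: the sum of the other entries of [c] divided by [c 0 i]. *)
have /choice[t tF] (i : 'I_n.+1) : exists t : 'rV_n, forall j, j != i -> dotv t (row j F) = -1.
  have [w Fw] : exists w : 'rV_n, F *m w^T =
      (\sum_k c 0 k / c 0 i) *: delta_mx i 0 - const_mx 1.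
    apply: (simplicial_solve sF c0 cF).
    rewrite mulmxBr -scalemxAr -colE; apply/rowP => k; rewrite !mxE.
    rewrite -mulr_suml divfK ?gt_eqF// [X in _ - X](_ : _ = \sum_k c 0 k) ?subrr//.
    by apply: eq_bigr => l _; rewrite ord1 mxE mulr1.
  by exists w => j ji; rewrite dotv_row Fw !mxE (negbTE ji) mulr0 sub0r.
(* Shifting by [s *: t i] raises the i-th product by at most e - s, so a point at depth e stays at
   depth s. *)
have [s s0 sP] : exists2 s : R, 0 < s & forall i, s * (1 + `|dotv (t i) (row i F)|) <= e.
  apply: finite_pos_min => [i s s' s0 s's|i].
    by apply: le_trans; rewrite ler_wpM2r.
  have a0 : 0 < 1 + `|dotv (t i) (row i F)| by rewrite ltr_pwDl.
  by exists (e / (1 + `|dotv (t i) (row i F)|)); rewrite ?divr_gt0 ?divfK ?gt_eqF.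
have [C C0 KC] := compact_coord_bounded cK.
(* The box is large enough to contain every K + [s *: t i]. *)
pose M := C + \sum_i \sum_l `|(s *: t i) 0 l|.
pose L : set 'rV[R]_n := [set x : 'rV[R]_n | (forall l, x 0 l \in `[- M, M]) /\
  forall j, dotv x (row j F) <= h j - s].
exists L; split.
- have cid : continuous (@idfun 'rV[R]_n) by move=> x; exact: cvg_id.
  apply: (@subclosed_compact _ _ [set x : 'rV[R]_n | forall l, [set` `[- M, M]] (x 0 l)]).
  + rewrite (_ : L = [set x : 'rV[R]_n | forall l, [set` `[- M, M]] (x 0 l)] `&`
      \bigcap_(j in [set: 'I_n.+1]) [set x : 'rV[R]_n | dotv x (row j F) <= h j - s]); last first.
      by apply/seteqP; split => x [xM xj]; split => // j; [move=> _|]; exact: xj.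
    apply: closedI.
      apply: compact_closed; first exact: norm_hausdorff.
      by apply: (@rV_compact R n (fun=> [set` `[- M, M]])) => i; exact: segment_compact.
    apply: closed_bigI => j _.
    have /continuous_closedP := dotv_continuous cid (@cst_continuous _ _ (row j F)).
    by move=> /(_ [set y | y <= h j - s]); apply; exact: closed_le.
  + by apply: (@rV_compact R n (fun=> [set` `[- M, M]])) => i; exact: segment_compact.
  + by move=> x [].
- move=> x y r [xM xF] [yM yF] r0 r1; split=> [l|j].
    have := xM l; have := yM l; rewrite !in_itv/= !mxE => /andP[y1 y2] /andP[x1 x2].
    by apply/andP; split; nra.
  rewrite dotvDl !dotvZl; have := xF j; have := yF j; nra.
- move=> X KX.
  (* Pigeonhole: otherwise each of d+2 disjoint caps contains one of the d+1 points. *)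
  have [i Xi] : exists i, forall k, dotv (X k) (row (g i) F) <= h (g i) - e.
    apply: contrapT => /forallNP H.
    have /choice[f fP] : forall i, exists k, h (g i) - e < dotv (X k) (row (g i) F).
      move=> i; apply: contrapT => /forallNP Hi; apply: (H i) => k.
      by rewrite leNgt; apply/negP; exact: Hi.
    have /injectivePn[i [j ij fij]] : ~~ injectiveb f.
      apply/negP => /injectiveP/leq_card; by rewrite !card_ord ltnn.
    have := eP (i, j) ij (X (f i)) (KX _).
    by move=> [|]; apply/negP; rewrite -ltNge /=; [|rewrite fij]; exact: fP.
  exists (s *: t (g i)) => k; split => [l|j].
    have : `|(X k + s *: t (g i)) 0 l| <= M.
      rewrite mxE (le_trans (ler_normD _ _))// lerD//; first exact: KC.
      rewrite (bigD1 (g i))//= (bigD1 l)//= -addrA lerDl.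
      by rewrite addr_ge0// sumr_ge0// => ? _; rewrite sumr_ge0.
    by rewrite in_itv/= ler_norml.
  rewrite dotvDl dotvZl; have [->|ji] := eqVneq j (g i).
    have := sP (g i); have := Xi k; rewrite mulrDr mulr1.
    have : s * dotv (t (g i)) (row (g i) F) <= s * `|dotv (t (g i)) (row (g i) F)|.
      by rewrite ler_pM2l// ler_norm.
    lra.
  by rewrite tF// mulrN1; have := exposes_le (Fq j) (KX k); rewrite /h; lra.
- move=> [v Lv].
  have vF j : dotv v (row j F) <= - s.
    by have [_ /(_ j)] := Lv _ (proj1 (Fq j)); rewrite dotvDl /h; lra.
  have : \sum_j c 0 j * dotv v (row j F) = 0.
    transitivity ((c *m (F *m v^T)) 0 0); last by rewrite mulmxA cF mul0mx mxE.
    by rewrite mxE; apply: eq_bigr => j _; rewrite dotv_row.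
  apply/eqP; rewrite lt_eqF// big_ord_recl; apply: ltr_wnDr; last first.
    by have := c0 ord0; have := vF ord0; nra.
  by apply: sumr_le0 => j _; have := c0 (lift ord0 j); have := vF (lift ord0 j); nra.
Qed.

(** * Helly's theorem, finite and compact versions *)

Lemma convex_weighted_mean (R : realType) (n : nat) (A : set 'rV[R]_n) (I : Type)
    (r : seq I) (P : pred I) (w : I -> R) (z : I -> 'rV[R]_n) :
  convex A -> (forall i, P i -> 0 < w i /\ A (z i)) -> 0 < \sum_(i <- r | P i) w i ->
  A ((\sum_(i <- r | P i) w i)^-1 *: \sum_(i <- r | P i) w i *: z i).
Proof.
move=> cA Pw; elim: r => [|i r IH]; first by rewrite big_nil ltxx.
rewrite !big_cons; case: ifP => // Pi _; have [wi Azi] := Pw i Pi.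
set W := \sum_(j <- r | P j) w j; set Z := \sum_(j <- r | P j) w j *: z j.
(* The weights are positive, so a zero total means that the tail has no selected index. *)
have [W0|W0] := eqVneq W 0.
  have -> : Z = 0.
    rewrite /Z; move: W0; rewrite /W; elim: (r) => [|j s IHs]; first by rewrite !big_nil.
    rewrite !big_cons; case: ifP => // Pj /eqP.
    rewrite paddr_eq0; last 2 first.
    - by rewrite ltW//; case: (Pw j Pj).
    - by apply: sumr_ge0 => k /Pw[/ltW].
    by move=> /andP[/eqP wj0 _]; have [] := Pw j Pj; rewrite wj0 ltxx.
  by rewrite W0 !addr0 scalerA mulVf ?scale1r// gt_eqF.
have Wp : 0 < W by rewrite lt_def W0; apply: sumr_ge0 => k /Pw[/ltW].
have wW : 0 < w i + W by rewrite addr_gt0.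
have -> : (w i + W)^-1 *: (w i *: z i + Z) =
    (w i / (w i + W)) *: z i + (1 - w i / (w i + W)) *: (W^-1 *: Z).
  rewrite scalerDr !scalerA mulrC; congr (_ + _ *: _).
  by field; rewrite !gt_eqF.
apply: cA => //; first exact: IH.
- by rewrite divr_ge0// ltW.
- by rewrite ler_pdivrMr// mul1r lerDl ltW.
Qed.

(** A column of ones turns affine dependence into linear dependence of more than d+1 rows of length
    d+1. *)
Lemma affine_dependent (R : realType) (d m : nat) (z : 'I_m -> 'rV[R]_d) :
  (d.+1 < m)%N -> exists a : 'I_m -> R,
    [/\ exists i, a i != 0, \sum_i a i = 0 & \sum_i a i *: z i = 0].
Proof.
move=> dm; pose A : 'M[R]_(m, d + 1) := row_mx (\matrix_i z i) (const_mx 1).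
pose v := nz_row (kermx A).
have v0 : v != 0.
  rewrite nz_row_eq0 -mxrank_eq0 mxrank_ker -lt0n subn_gt0.
  by apply: leq_ltn_trans (rank_leq_col A) _; rewrite addn1.
have : v *m A = 0 by apply/sub_kermxP; exact: nz_row_sub.
rewrite mul_mx_row -[RHS](row_mx0) => /eq_row_mx[vz v1].
exists (fun i => v 0 i); split.
- exact/rV0Pn.
- transitivity ((v *m (const_mx 1 : 'cV_m)) 0 0); last by rewrite v1 mxE.
  by rewrite mxE; apply: eq_bigr => i _; rewrite mxE mulr1.
- by rewrite -[RHS]vz mulmx_sum_row; apply: eq_bigr => i _; rewrite rowK.
Qed.

(** Induction on the number of sets, through a Radon partition of points [z i] that lie in every set
    but the i-th. *)
Lemma helly_finite (R : realType) (d m : nat) (A : 'I_m -> set 'rV[R]_d) :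
  (forall i, convex (A i)) ->
  (forall f : 'I_d.+1 -> 'I_m, exists x, forall k, A (f k) x) ->
  exists x, forall i, A i x.
Proof.
elim: m A => [|m IH] A cA Af; first by exists 0 => -[].
have [md|dm] := leqP m.+1 d.+1.
  (* With at most d+1 sets, a single choice of f, possibly with repetitions, lists them all. *)
  have [x xA] := Af (fun k => inord k); exists x => i.
  have := xA (inord i); rewrite inordK ?inord_val//.
  exact: leq_trans (ltn_ord i) md.
have /choice[z zA] (i : 'I_m.+1) : exists x, forall j, j != i -> A j x.
  have [x xA] := IH (fun j => A (lift i j)) (fun j => cA _) (fun f => Af (lift i \o f)).
  exists x => j; case: (unliftP i j) => [k ->|->]; first by move=> _; exact: xA.
  by rewrite eqxx.
have [a [[i0 ai0] a0 az]] := affine_dependent z dm.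
wlog ai0p : a ai0 a0 az / 0 < a i0.
  move=> H; have [ai|ai|ai] := ltrgtP (a i0) 0; last by rewrite ai eqxx in ai0.
    apply: (H (fun i => - a i)); rewrite ?oppr_eq0 ?oppr_gt0//.
      by rewrite sumrN a0 oppr0.
    by under eq_bigr do rewrite scaleNr; rewrite sumrN az oppr0.
  exact: (H a).
pose S := \sum_(i | 0 < a i) a i.
have Sp : 0 < S.
  rewrite /S (bigD1 i0)//=; apply: ltr_pwDl => //.
  by apply: sumr_ge0 => i /andP[/ltW].
have SN : S = \sum_(i | a i < 0) - a i.
  move: a0; rewrite (bigID (fun i => 0 < a i))/= -/S => /eqP; rewrite addr_eq0 => /eqP ->.
  rewrite sumrN; congr (- _); rewrite [LHS](bigID (fun i => a i < 0))/= [X in _ + X]big1.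
    rewrite addr0; apply: eq_bigl => i; case: ltrgtP => //.
  by move=> i /andP[]; rewrite -!leNgt => ? ?; apply/eqP; rewrite eq_le; apply/andP.
have zN : \sum_(i | 0 < a i) a i *: z i = \sum_(i | a i < 0) - a i *: z i.
  move: az; rewrite (bigID (fun i => 0 < a i))/= => /eqP; rewrite addr_eq0 => /eqP ->.
  under [RHS]eq_bigr do rewrite scaleNr.
  rewrite sumrN; congr (- _); rewrite [LHS](bigID (fun i => a i < 0))/= [X in _ + X]big1.
    rewrite addr0; apply: eq_bigl => i; case: ltrgtP => //.
  move=> i /andP[]; rewrite -!leNgt => ? ?.
  by rewrite (_ : a i = 0) ?scale0r//; apply/eqP; rewrite eq_le; apply/andP.
(* The Radon point is a mean over positive indices and over negative ones; for each j, the side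
   avoiding j shows membership in [A j]. *)
exists (S^-1 *: \sum_(i | 0 < a i) a i *: z i) => j.
have [aj|aj] := ltP 0 (a j).
  rewrite zN SN; apply: convex_weighted_mean => //; last by rewrite -SN.
  move=> i ai; rewrite oppr_gt0; split => //; apply: zA.
  by apply: contraTneq aj => ->; rewrite -leNgt ltW.
apply: convex_weighted_mean => // i ai; split => //; apply: zA.
by apply: contraTneq aj => ->; rewrite -ltNge.
Qed.

Lemma helly_compact (R : realType) (d : nat) (I : choiceType) (D : set I)
    (A : I -> set 'rV[R]_d) :
  (forall i, D i -> compact (A i) /\ convex (A i)) ->
  (forall f : 'I_d.+1 -> I, (forall k, D (f k)) -> exists x, forall k, A (f k) x) ->
  exists x, forall i, D i -> A i x.
Proof.
move=> cA Af; have [[i0 Di0]|D0] := pselect (exists i, D i); last first.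
  by exists 0 => i Di; case: D0; exists i.
have [cA0 _] := cA _ Di0.
(* Intersecting every set with [A i0] places the family inside one compact set, so finite
   intersections suffice. *)
have := cA0; rewrite compact_In0 => /(_ I D (fun i => A i0 `&` A i)) [||x xP].
- exists A => // i Di; apply: compact_closed; first exact: norm_hausdorff.
  by case: (cA _ Di).
- move=> D' D'D.
  pose s : seq I := i0 :: finmap.enum_fset D'.
  have sD i : i \in s -> D i.
    by rewrite inE => /orP[/eqP->//|/D'D]; rewrite inE.
  have [x xs] : exists x, forall i : 'I_(size s), A (nth i0 s i) x.
    apply: helly_finite => [i|f]; first by have [] := cA _ (sD _ (mem_nth i0 (ltn_ord i))).
    by apply: (Af (fun k => nth i0 s (f k))) => k; apply: sD; exact: mem_nth.
  have {}xs i : i \in s -> A i x.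
    by move=> si; rewrite -(nth_index i0 si); apply: (xs (Ordinal _)); rewrite index_mem.
  exists x => i /= iD'; split; apply: xs; first exact: mem_head.
  by rewrite inE iD' orbT.
by exists x => i Di; have [] := xP i Di.
Qed.

(** * Coordinates on a subspace and translates of projections *)

Lemma mulmxr_continuous (R : realType) (n m : nat) (B : 'M[R]_(n, m)) :
  continuous (fun x : 'rV[R]_n => x *m B).
Proof.
rewrite (_ : (fun _ => _) = (fun x : 'rV[R]_n => \sum_i x 0 i *: row i B)); last first.
  by apply/funext => x; exact: mulmx_sum_row.
elim: (index_enum _) => [|i s IH] x.
  rewrite (_ : (fun _ => _) = cst 0); last by apply/funext => y; rewrite big_nil.
  exact: cst_continuous.
rewrite (_ : (fun _ => _) = (fun y : 'rV[R]_n => y 0 i *: row i B) \+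
    (fun y : 'rV[R]_n => \sum_(j <- s) y 0 j *: row j B)); last first.
  by apply/funext => y; rewrite big_cons.
apply: continuousD (IH x).
apply: (@continuous_comp _ _ _ (fun y : 'rV[R]_n => y 0 i) (fun k => k *: row i B)).
  exact: coord_continuous.
exact: scalel_continuous.
Qed.

(** If v annihilates the Gram matrix, the squared norm of [v *m B] is 0. *)
Lemma gram_unitmx (R : realType) (m n : nat) (B : 'M[R]_(m, n)) :
  row_free B -> B *m B^T \in unitmx.
Proof.
move=> fB; rewrite -row_free_unit; apply/inj_row_free => v; rewrite mulmxA => vBB.
apply: (row_free_inj fB); rewrite mul0mx.
have [//|/dotv_gt0] := eqVneq (v *m B) 0.
by rewrite dotv_mxE trmx_mul mulmxA vBB mul0mx mxE ltxx.
Qed.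

(* Helly's theorem in coordinates [x |-> x B^T] on the subspace, applied to the
   sets of translations moving a given point of [K] into [L]. *)
Lemma proj_contains_translate (R : realType) (n : nat) (U : 'M[R]_n)
    (K L : set 'rV[R]_n) :
  compact L -> convex L ->
  (forall X : 'I_(\rank U).+1 -> 'rV[R]_n, (forall k, K (X k)) ->
    exists t, forall k, L (X k + t)) ->
  contains_translate (proj_set U L) (proj_set U K).
Proof.
move=> cL cvL LK; pose B := row_base U.
have [y yA] : exists y, forall x, K x -> [set (z - x) *m B^T | z in L] y.
  apply: (@helly_compact R _ _ K (fun x => [set (z - x) *m B^T | z in L])).
    move=> x Kx; split.
      apply: continuous_compact => //; apply: continuous_subspaceT.
      rewrite (_ : (fun _ => _) = (fun z : 'rV[R]_n => z *m B^T) \- cst (x *m B^T)).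
        move=> z; apply: continuousB; last exact: cst_continuous.
        exact: mulmxr_continuous.
      by apply/funext => z; rewrite mulmxBl.
    move=> _ _ t [a La <-] [b Lb <-] t0 t1.
    exists (t *: a + (1 - t) *: b); first exact: cvL.
    rewrite !scalemxAl -mulmxDl; congr (_ *m _); apply/rowP => j.
    by rewrite !mxE; ring.
  move=> X KX; have [t Lt] := LK X KX.
  exists (t *m B^T) => k; exists (X k + t) => //.
  by rewrite addrC addKr.
have gB := gram_unitmx (row_base_free U).
(* The vector of the subspace whose products with the basis rows are [y]. *)
pose v := y *m invmx (B *m B^T) *m B.
have vB : v *m B^T = y by rewrite /v -2!mulmxA mulVmx// mulmx1.
have vU : (v <= U)%MS by rewrite -(eq_row_base U) submxMl.
have orth (x w : 'rV[R]_n) : x *m B^T = 0 -> (w <= U)%MS -> dotv x w = 0.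
  move=> xB; rewrite -(eq_row_base U) => /submxP[c ->].
  by rewrite dotv_mxE trmx_mul mulmxA xB mul0mx mxE.
exists v => a [aU [x Kx xa]]; split; first exact: addmx_sub.
have [z Lz zx] := yA x Kx; exists z => // w wU.
have xaB : (x - a) *m B^T = 0.
  apply/rowP => j; rewrite [RHS]mxE -(xa (row j B)); last first.
    by rewrite /in_subspace -(eq_row_base U) row_sub.
  by rewrite dotv_row -[B in RHS]trmxK -trmx_mul [RHS]mxE.
(* Against the basis the three pieces give y, 0 and -y. *)
apply: orth wU; rewrite (_ : z - (a + v) = (z - x) + (x - a) - v).
  by rewrite mulmxBl mulmxDl zx xaB vB addr0 subrr.
by rewrite addrA subrK opprD addrA.
Qed.

Theorem theorem3p7 (R : realType) (n d : nat) (K : set 'rV[R]_n) :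
  (1 <= d)%N -> (d < n)%N ->
  compact K -> convex K ->
  (exists p : 'I_(d.+2) -> 'rV[R]_n,
      injective p /\ forall i, exposed_point K (p i)) ->
  exists L : set 'rV[R]_n,
    [/\ compact L, convex L,
        (forall U : 'M[R]_n, \rank U = d ->
            contains_translate (proj_set U L) (proj_set U K))
      & ~ contains_translate L K].
Proof.
move=> _ dn cK _ pK.
have [L [cL cvL LK nLK]] := contains_translates_not_translate dn cK pK.
exists L; split => // U rU.
by apply: proj_contains_translate => //; rewrite rU.
Qed.
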